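(* Let $p>1$ and let $G=(V,E)$ be a finite connected graph with vertex measure $\mu$ and symmetric edge measure $\omega$. Let $c>0$ be a constant and let $h\in C(V)$. Then the equation $$\Delta_p u=c-he^{u}\quad\text{in } V$$ has a solution $u\in C(V)$ if and only if $h$ is positive somewhere, i.e. $h_i>0$ for some $i\in V$.
   Context: $G=(V,E)$ is a finite connected graph with vertex set $V$ and edge set $E$; $i\sim j$ means that $i,j\in V$ are joined by an edge. $\mu:V\to(0,+\infty)$ is a fixed vertex measure and $\omega:E\to(0,+\infty)$ is a fixed edge measure, symmetric: $\omega_{ij}=\omega_{ji}$ for each edge $i\sim j$. $C(V)$ is the finite-dimensional vector space of all real functions on $V$. For $p>1$ the discrete $p$-Laplacian $\Delta_p:C(V)\to C(V)$ is $$\Delta_p f_i=\frac{1}{\mu_i}\sum_{j\sim i}\omega_{ij}|f_j-f_i|^{p-2}(f_j-f_i),\qquad i\in V,$$ where $|t|^{p-2}t$ is understood to be $0$ at $t=0$. *)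

(* Defs.v *)
From HB Require Import structures.
From mathcomp Require Import all_boot all_order all_algebra.
From mathcomp Require Import all_classical all_reals all_analysis.

Set Implicit Arguments.
Unset Strict Implicit.
Unset Printing Implicit Defensive.

Import Order.TTheory GRing.Theory Num.Theory.

Local Open Scope ring_scope.

Definition simple_graph (V : finType) (e : rel V) : Prop :=
  symmetric e /\ irreflexive e.

(* [connect e] is the reflexive transitive closure of [e]; a connected graph
   has at least one vertex. *)
Definition connected_graph (V : finType) (e : rel V) : Prop :=
  (0 < #|V|)%N /\ forall i j : V, connect e i j.

(* An edge measure is a function on ordered pairs of vertices whose values off
   the edges are irrelevant. *)
Definition edge_measure (R : realType) (V : finType) (e : rel V)
    (omega : V -> V -> R) : Prop :=
  forall i j : V, e i j -> 0 < omega i j /\ omega i j = omega j i.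

(* At [f j = f i] the summand is 0 because of the factor [f j - f i], whatever
   the value of [0 `^ (p - 2)]. *)
Definition p_laplacian (R : realType) (V : finType) (e : rel V)
    (mu : V -> R) (omega : V -> V -> R) (p : R) (f : V -> R) (i : V) : R :=
  (mu i)^-1 *
    \sum_(j | e i j) omega i j * (`|f j - f i| `^ (p - 2) * (f j - f i)).

(* Main.v *)
Require Import Defs.
From HB Require Import structures.
From mathcomp Require Import all_boot all_order all_algebra.
From mathcomp Require Import all_classical all_reals all_analysis.
From mathcomp Require Import ring lra.

Set Implicit Arguments.
Unset Strict Implicit.

Import Order.TTheory GRing.Theory Num.Theory.
Import numFieldNormedType.Exports.

Local Open Scope classical_set_scope.
Local Open Scope ring_scope.

(** Summing the equation against [mu] kills the p-Laplacian (discrete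
    integration by parts, [p_laplacian_by_parts]) and leaves
    c Vol = sum_i mu_i h_i e^(u_i), so a solution forces h to be positive
    somewhere.

    Conversely, write I(u) = sum_i mu_i h_i e^(u_i) and
      J(u) = (E(u) + c sum_i mu_i u_i) / (c Vol),
    where E(u) is 1/p times the sum over unoriented edges of
    omega_ij |u_j - u_i|^p.  Constrained minimisation of J on the surface
    I = c Vol is replaced by unconstrained maximisation of
      Phi(u) = I(u) e^(-J(u)),
    which is differentiable on the whole space, so neither a Lagrange multiplier nor
    the logarithm of I is needed.  Adding a constant a to u multiplies I by
    e^a and adds a to J, so Phi is shift invariant ([objective_shift]).

    Normalise u to vanish at a vertex m.  Since the graph is connected, the
    weighted sum of |u_j - u_i| over the edges controls the sum of the |u_i|
    ([sum_norm_le_edge_variation]); since p > 1, |t|^p dominates every linear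
    function of |t|.  Hence J(u) >= 2 sum_i |u_i| - D and
    Phi(u) <= C e^(- sum_i |u_i|) ([objective_decay]).  If h is positive at k,
    then I, hence Phi, is positive at a function concentrated at k, and Phi
    attains a positive global maximum on a compact box
    ([objective_attains_max]).  At a maximum u all directional derivatives
    vanish, and [is_derive_objective] turns this into
      Delta_p u = c - (c Vol / I(u)) h e^u.
    Replacing u by u + ln (c Vol / I(u)) gives a solution. *)

(** * The function t |-> |t|^p *)

Section NormPower.
Variables (R : realType) (p : R).
Hypothesis hp : 1 < p.

(** Superlinear growth: |t|^p >= a |t| as soon as |t|^(p - 1) >= a, and
    otherwise the subtracted constant exceeds a |t|. *)
Lemma powR_superlinear (a t : R) : 0 <= a ->
  a * `|t| - a * a `^ (p - 1)^-1 <= `|t| `^ p.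
Proof.
move=> a0; have p1 : 0 < p - 1 by rewrite subr_gt0.
have [tT|Tt] := leP `|t| (a `^ (p - 1)^-1).
  by rewrite (le_trans _ (powR_ge0 _ _))// -mulrBr mulr_ge0_le0// subr_le0.
have aE : a = (a `^ (p - 1)^-1) `^ (p - 1).
  by rewrite -powRrM mulVf ?gt_eqF// powRr1.
rewrite lerBlDr (le_trans _ (_ : `|t| `^ p <= _))//; last first.
  by rewrite lerDl mulr_ge0// powR_ge0.
rewrite -mulr_powRB1// ?(lt_trans _ hp)// mulrC ler_wpM2l//.
by rewrite {1}aE ge0_ler_powR ?nnegrE ?powR_ge0// ltW.
Qed.

Lemma is_derive_norm_powR (x : R) :
  is_derive x 1 (fun t : R => `|t| `^ p) (p * (`|x| `^ (p - 2) * x)).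
Proof.
have p0 : 0 < p by rewrite (lt_trans _ hp).
have p2E : p - 1 = p - 2 + 1 by ring.
have powE (y : R) : 0 < y -> y `^ (p - 1) = y `^ (p - 2) * y.
  move=> y0; rewrite p2E (@powRD _ _ (p - 2)); last first.
    by rewrite (gt_eqF y0) implybT.
  by rewrite powRr1// ltW.
have [x0|x0|->] := ltgtP x 0.
- have xN0 : 0 < - x by rewrite oppr_gt0.
  apply: (@near_eq_is_derive R R R (fun t : R => (- t) `^ p)).
    near=> t; rewrite /= ltr0_norm//.
    by near: t; exact: lt_nbhsl.
  have := @is_derive1_comp R (fun t : R => t `^ p) (fun t : R => - t) x _ _
    (is_derive1_powR p xN0) (is_deriveNid _ _).
  move=> /is_derive_eq; apply; rewrite ltr0_norm// powE//; ring.
- apply: (@near_eq_is_derive R R R (fun t : R => t `^ p)).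
    near=> t; rewrite /= gtr0_norm//.
    by near: t; exact: lt_nbhsr.
  apply: is_derive_eq; first exact: is_derive1_powR.
  by rewrite gtr0_norm// powE.
(* At 0 the difference quotient is [`|t| `^ (p - 2) * t], of absolute value
   [`|t| `^ (p - 1)], which tends to 0 because 1 < p. *)
- apply/is_derive1_caratheodory.
  exists (fun t => `|t| `^ (p - 2) * t); split.
  + move=> z; rewrite normr0 powR0 ?gt_eqF// !subr0 -mulrA -expr2.
    have [->|z0] := eqVneq z 0; first by
      rewrite normr0 powR0 ?gt_eqF// expr0n mulr0.
    rewrite -[z ^+ 2]real_normK ?num_real// expr2 mulrA -powE ?normr_gt0//.
    by rewrite mulrC mulr_powRB1.
  + suff : (fun t : R => `|t| `^ (p - 2) * t) z @[z --> (0 : R)] --> (0 : R).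
      by rewrite /prop_for /continuous_at /= mulr0.
    apply/cvgr0Pnorm_lt => eps eps0.
    have p1 : 0 < p - 1 by rewrite subr_gt0.
    have near0 : \forall z \near (0 : R), `|z| < eps `^ (p - 1)^-1.
      by apply: nbhs0_lt; exact: powR_gt0.
    near=> z; have [->|z0] := eqVneq z 0; first by rewrite mulr0 normr0.
    rewrite normrM ger0_norm ?powR_ge0// -powE ?normr_gt0//.
    have -> : eps = (eps `^ (p - 1)^-1) `^ (p - 1).
      by rewrite -powRrM mulVf ?gt_eqF// powRr1// ltW.
    rewrite gt0_ltr_powR ?nnegrE ?powR_ge0//.
    by near: z; exact: near0.
  + by rewrite !mulr0.
Unshelve. all: by end_near. Qed.

End NormPower.

Lemma is_derive_bigsum (R : numFieldType) (V W : normedModType R) (I : Type)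
    (r : seq I) (P : pred I) (F : I -> V -> W) (dF : I -> W) (x v : V) :
  (forall i, P i -> is_derive x v (F i) (dF i)) ->
  is_derive x v (fun t => \sum_(i <- r | P i) F i t) (\sum_(i <- r | P i) dF i).
Proof.
move=> H; rewrite -fct_sumE.
apply: (big_ind2 (fun f d => is_derive x v f d)) => //.
  exact: is_derive_cst.
by move=> *; exact: is_deriveD.
Qed.

Lemma is_derive_line (R : realType) (f : R -> R) (a b t df : R) :
  is_derive (a + t * b) 1 f df ->
  is_derive t 1 (fun s => f (a + s * b)) (df * b).
Proof.
move=> dfl; apply: (@is_derive1_comp R f (fun s => a + s * b)) => //.
apply/is_derive1_caratheodory; exists (fun=> b); split=> //.
  by move=> z; ring.
exact: cst_continuous.
Qed.

(** * Integration by parts and a Poincare inequality on graphs *)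

Section GraphInequalities.
Variables (R : realType) (V : finType) (e : rel V) (omega : V -> V -> R).
Hypotheses (he : simple_graph e) (homega : edge_measure e omega).

(** The left-hand sum ranges over oriented edges, so that each edge is counted
    twice: this is where the factor 2 comes from. *)
Lemma p_laplacian_by_parts (mu : V -> R) (p : R) (u v : V -> R) :
  (forall i, 0 < mu i) ->
  \sum_i \sum_(j | e i j)
     omega i j * (`|u j - u i| `^ (p - 2) * (u j - u i)) * (v j - v i) =
  - 2 * \sum_i mu i * p_laplacian e mu omega p u i * v i.
Proof.
move=> hmu; have [esym _] := he.
pose F i j := omega i j * (`|u j - u i| `^ (p - 2) * (u j - u i)).
have FN i j : e i j -> F j i = - F i j.
  move=> eij; rewrite /F (homega eij).2 distrC -[u i - u j]opprB.
  by rewrite !mulrN.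
rewrite (_ : \sum_i mu i * p_laplacian e mu omega p u i * v i =
    \sum_i \sum_(j | e i j) F i j * v i); last first.
  apply: eq_bigr => i _; rewrite /p_laplacian mulrA mulfV ?gt_eqF// mul1r.
  by rewrite mulr_suml.
have S2 : \sum_i \sum_(j | e i j) F i j * v j =
    - \sum_i \sum_(j | e i j) F i j * v i.
  rewrite (exchange_big_dep xpredT)//= -sumrN; apply: eq_bigr => i _.
  rewrite -sumrN; apply: eq_big => [j|j eji]; first by rewrite esym.
  by rewrite -mulNr -FN// esym.
have -> : - 2 * \sum_i \sum_(j | e i j) F i j * v i =
    \sum_i \sum_(j | e i j) F i j * v j - \sum_i \sum_(j | e i j) F i j * v i.
  by rewrite S2; ring.
rewrite -sumrN -big_split/=.
apply: eq_bigr => i _; rewrite -sumrN -big_split/=; apply: eq_bigr => j _.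
by rewrite mulrBr.
Qed.

(** A Poincare inequality: along a path from [m] to [i] the increments of [u]
    add up to [u i - u m], and each of them is at most the total edge variation
    divided by the weight of the edge. *)
Lemma sum_norm_le_edge_variation (m : V) : (forall i, connect e m i) ->
  exists2 K : R, 0 <= K & forall u : V -> R, u m = 0 ->
    \sum_i `|u i| <=
      K * \sum_i \sum_(j | e i j) omega i j * `|u j - u i|.
Proof.
move=> hc.
pose S (u : V -> R) := \sum_i \sum_(j | e i j) omega i j * `|u j - u i|.
have t0 u i j : e i j -> 0 <= omega i j * `|u j - u i|.
  by move=> eij; rewrite mulr_ge0// ltW// (homega eij).1.
have edge u i j : e i j -> `|u j - u i| <= (omega i j)^-1 * S u.
  move=> eij; have w0 := (homega eij).1.
  rewrite mulrC ler_pdivlMr// mulrC /S (bigD1 i)//= (bigD1 j)//= -addrA lerDl.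
  rewrite addr_ge0// ?sumr_ge0// => [k /andP[eik _]|k _]; first exact: t0.
  by rewrite sumr_ge0// => l; exact: t0.
have S0 u : 0 <= S u by rewrite /S; apply: sumr_ge0 => i _; exact/sumr_ge0/t0.
have pathB i : exists2 K, 0 <= K &
    forall u : V -> R, `|u i - u m| <= K * S u.
  have /connectP[s] := hc i; elim/last_ind: s i => [|s k IH] i /=.
    by move=> _ ->; exists 0 => // u; rewrite subrr normr0 mul0r.
  rewrite rcons_path last_rcons => /andP[ps ek] ->.
  have [K K0 HK] := IH _ ps erefl.
  exists ((omega (last m s) k)^-1 + K).
    by rewrite addr_ge0// invr_ge0 ltW// (homega ek).1.
  move=> u; rewrite mulrDl (le_trans (ler_distD (u (last m s)) _ _))//.
  by rewrite lerD// edge.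
have {}pathB i := cid2 (pathB i).
exists (\sum_i s2val (pathB i)).
  by rewrite sumr_ge0// => i _; exact: (s2valP (pathB i)).
move=> u um; rewrite mulr_suml ler_sum// => i _.
by have := s2valP' (pathB i) u; rewrite um subr0.
Qed.

End GraphInequalities.

(** * The functional to be maximised *)

Section Functional.
Variables (R : realType) (V : finType) (e : rel V) (mu : V -> R).
Variables (omega : V -> V -> R) (p c : R) (h : V -> R).

(** The p-Dirichlet energy, summed over oriented edges: every edge is counted
    twice, and the factor 1/p is left out. *)
Definition energy (u : V -> R) : R :=
  \sum_i \sum_(j | e i j) omega i j * `|u j - u i| `^ p.

(** The integral of [h e^u] against [mu]. *)
Definition mass (u : V -> R) : R := \sum_i mu i * h i * expR (u i).

(** The total measure of the graph. *)
Definition vol : R := \sum_i mu i.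

(** The Lagrangian part of the problem, scaled by [c * vol] so that adding the
    constant [a] to [u] adds exactly [a].  The factor [(2 * p)^-1] supplies the
    1/p left out of [energy] and makes up for its double counting of edges. *)
Definition penalty (u : V -> R) : R :=
  ((2 * p)^-1 * energy u + c * \sum_i mu i * u i) / (c * vol).

(** The shift-invariant functional whose positive maxima solve the equation up
    to an additive constant. *)
Definition objective (u : V -> R) : R := mass u * expR (- penalty u).

Hypotheses (he : simple_graph e) (homega : edge_measure e omega).
Hypotheses (hmu : forall i, 0 < mu i) (hp : 1 < p) (hc : 0 < c).
Hypothesis hconn : connected_graph e.

Lemma vol_gt0 : 0 < vol.
Proof.
have [V0 _] := hconn; have /card_gt0P[m _] := V0.
rewrite /vol (bigD1 m)//= ltr_pwDl// sumr_ge0// => i _; exact: ltW.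
Qed.

Let cvol0 : 0 < c * vol. Proof. by rewrite mulr_gt0// vol_gt0. Qed.

Lemma mass_shift (a : R) u : mass (fun i => u i + a) = expR a * mass u.
Proof.
rewrite /mass mulr_sumr; apply: eq_bigr => i _; rewrite expRD; ring.
Qed.

Lemma p_laplacian_shift (a : R) u i :
  p_laplacian e mu omega p (fun i => u i + a) i = p_laplacian e mu omega p u i.
Proof.
rewrite /p_laplacian; congr (_ * _); apply: eq_bigr => j _.
by rewrite opprD addrACA subrr addr0.
Qed.

Lemma penalty_shift (a : R) u : penalty (fun i => u i + a) = penalty u + a.
Proof.
rewrite /penalty (_ : energy (fun i => _) = energy u); last first.
  apply: eq_bigr => i _; apply: eq_bigr => j _.
  by rewrite opprD addrACA subrr addr0.
rewrite (_ : \sum_i mu i * (u i + a) = \sum_i mu i * u i + vol * a).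
  by field; rewrite gt_eqF ?vol_gt0// gt_eqF// gt_eqF// (lt_trans _ hp).
by rewrite /vol mulr_suml -big_split/=; apply: eq_bigr => i _; rewrite mulrDr.
Qed.

Lemma objective_shift (a : R) u : objective (fun i => u i + a) = objective u.
Proof.
rewrite /objective mass_shift penalty_shift opprD expRD [expR (- a)]expRN.
by field; rewrite gt_eqF ?expR_gt0.
Qed.

Lemma objective_decay (m : V) : exists2 C : R, 0 < C &
  forall u, u m = 0 -> objective u <= C * expR (- \sum_i `|u i|).
Proof.
have p0 : 0 < p by rewrite (lt_trans _ hp).
have [K K0 HK] :=
  sum_norm_le_edge_variation homega (m := m) (fun i => hconn.2 m i).
set B := \sum_i mu i * `|h i|.
have B0 : 0 <= B by rewrite sumr_ge0// => i _; rewrite mulr_ge0// ltW.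
set W := \sum_i \sum_(j | e i j) omega i j.
have L'0 : 0 <= 2 * p * (3 * (c * vol)).
  by apply: ltW; rewrite !mulr_gt0 ?vol_gt0.
(* The slope [L] makes the energy contribute [3 * S] to the penalty: one [S] is
   lost to the linear term, and another to the mass. *)
set L := 2 * p * (3 * (c * vol)) * K.
have L0 : 0 <= L by rewrite mulr_ge0.
set b := L * L `^ (p - 1)^-1.
set D := ((2 * p)^-1 * (b * W)) / (c * vol).
exists ((B + 1) * expR D).
  by rewrite mulr_gt0 ?expR_gt0// ltr_wpDl.
move=> u um; set S := \sum_i `|u i|.
have uS i : `|u i| <= S.
  by rewrite /S (bigD1 i)//= lerDl sumr_ge0.
have massS : mass u <= (B + 1) * expR S.
  apply: (@le_trans _ _ (B * expR S)); last first.
    by rewrite ler_wpM2r ?expR_ge0// lerDl.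
  rewrite /mass /B mulr_suml ler_sum// => i _.
  apply: (@le_trans _ _ (mu i * `|h i| * expR (u i))).
    by rewrite ler_wpM2r ?expR_ge0// ler_wpM2l ?ler_norm// ltW.
  apply: ler_wpM2l; first by rewrite mulr_ge0// ltW.
  by rewrite ler_expR (le_trans (ler_norm _)).
have energyS : 2 * p * (3 * (c * vol)) * S - b * W <= energy u.
  apply: (@le_trans _ _ (L * (\sum_i \sum_(j | e i j) omega i j * `|u j - u i|)
      - b * W)).
    rewrite lerB// /L -[leRHS]mulrA ler_wpM2l ?HK//.
  rewrite /W !mulr_sumr -sumrB; apply: ler_sum => i _.
  rewrite !mulr_sumr -sumrB; apply: ler_sum => j eij.
  rewrite [L * _]mulrCA [b * _]mulrC -mulrBr ler_wpM2l ?powR_superlinear//.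
  by rewrite ltW// (homega eij).1.
have linS : - (vol * S) <= \sum_i mu i * u i.
  rewrite /vol mulr_suml -sumrN; apply: ler_sum => i _.
  rewrite -mulrN (ler_wpM2l (ltW (hmu i)))// lerNl (le_trans _ (uS i))//.
  by rewrite -normrN ler_norm.
have penS : 2 * S - D <= penalty u.
  rewrite /penalty ler_pdivlMr// /D.
  apply: (@le_trans _ _ ((2 * p)^-1 * (2 * p * (3 * (c * vol)) * S - b * W)
      + c * - (vol * S))).
    rewrite le_eqVlt; apply/orP; left; apply/eqP; field.
    by rewrite !gt_eqF// vol_gt0.
  by rewrite lerD// ler_wpM2l// ?invr_ge0 ltW ?mulr_gt0.
rewrite /objective -mulrA -expRD.
apply: (@le_trans _ _ ((B + 1) * expR S * expR (- penalty u))).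
  by rewrite ler_wpM2r ?expR_ge0.
rewrite -mulrA -expRD ler_wpM2l ?addr_ge0// ler_expR; lra.
Qed.

(** Continuity for the topology of pointwise convergence. *)
Lemma objective_continuous : continuous (objective : {ptws V -> R} -> R).
Proof.
have sumC (I : Type) (r : seq I) (P : pred I) (f : I -> {ptws V -> R} -> R) :
    (forall i, P i -> continuous (f i)) ->
    continuous (fun u : {ptws V -> R} => \sum_(i <- r | P i) f i u).
  move=> H; rewrite -fct_sumE; apply: (big_ind (fun f => continuous f)) => //.
    by move=> x; exact: cst_continuous.
  by move=> f1 f2 c1 c2 x; apply: continuousD; [exact: c1|exact: c2].
have projC i : continuous (fun u : {ptws V -> R} => u i).
  exact: (@proj_continuous V (fun=> R) i).
have mulC a (f : {ptws V -> R} -> R) : continuous f ->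
    continuous (fun u => a * f u).
  by move=> cf x; apply: continuousM; [exact: cst_continuous|exact: cf].
have powC : continuous (fun t : R => `|t| `^ p).
  move=> t; apply/differentiable_continuous/derivable1_diffP.
  exact: (@ex_derive _ _ _ _ _ _ _ (is_derive_norm_powR hp t)).
move=> u; apply: continuousM.
  apply: (sumC) => i _; apply: (mulC) => {}u.
  by apply: continuous_comp; [exact: projC|exact: continuous_expR].
apply: (@continuous_comp _ _ _ (fun u : {ptws V -> R} => - penalty u) expR).
  apply: continuousN; apply: continuousM; last exact: cst_continuous.
  apply: continuousD; apply: (mulC).
    apply: (sumC) => i _; apply: (sumC) => j _; apply: (mulC) => {}u.
    apply: (@continuous_comp _ _ _ (fun u : {ptws V -> R} => u j - u i)
        (fun t : R => `|t| `^ p)); last exact: powC.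
    by apply: continuousB; exact: projC.
  by apply: (sumC) => i _; apply: (mulC).
exact: continuous_expR.
Qed.

Lemma objective_attains_max (w : V -> R) : 0 < objective w ->
  exists u0, forall u, objective u <= objective u0.
Proof.
move=> w0; have [V0 _] := hconn; have /card_gt0P[m _] := V0.
have [C C0 HC] := objective_decay m.
(* [M] is chosen so that the decay bound [C * expR (- M)] is at most
   [objective w]. *)
pose M := Num.max 0 (ln (C / objective w)).
have CM : C * expR (- M) <= objective w.
  rewrite expRN ler_pdivrMr ?expR_gt0// mulrC -ler_pdivrMr//.
  rewrite -[leLHS]lnK ?posrE ?divr_gt0// ler_expR le_max lexx orbT//.
pose A : set {ptws V -> R} := [set f | forall i, `[- M, M]%classic (f i)].
have M0 : 0 <= M by rewrite le_max lexx.
have cA : compact A.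
  exact: (@tychonoff V (fun=> R) (fun=> `[- M, M]%classic)
    (fun=> @segment_compact R (- M) M)).
have A0 : A !=set0.
  by exists (fun=> 0) => i /=; rewrite in_itv/= oppr_le0 M0.
have [u0 _ max0] :=
  compact_EVT_max A0 cA (continuous_subspaceT objective_continuous).
(* Once normalised at [m], a function lies in the box or does worse than [w]. *)
have dich u : A (fun i => u i - u m) \/ objective u < objective w.
  set v := fun i => u i - u m.
  have -> : objective u = objective v by rewrite -(objective_shift (- u m)).
  have [vM|Mv] := leP (\sum_i `|v i|) M; [left => i /=|right].
    rewrite in_itv/= -ler_norml (le_trans _ vM)//.
    by rewrite (bigD1 i)//= lerDl sumr_ge0.
  rewrite (le_lt_trans (HC _ _))// ?/v ?subrr// (lt_le_trans _ CM)//.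
  by rewrite ltr_pM2l// ltr_expR ltrN2.
have box u : A (fun i => u i - u m) -> objective u <= objective u0.
  by move=> Au; rewrite -(objective_shift (- u m) u); apply: max0; rewrite inE.
(* In particular [w] itself lies in the box. *)
have ww0 : objective w <= objective u0.
  by have [/box//|] := dich w; rewrite ltxx.
exists u0 => u; have [/box//|/ltW uw] := dich u; exact: le_trans ww0.
Qed.

(** The directional derivative of the functional, at an arbitrary point [U] of
    the line [u + s v]. *)
Lemma is_derive_objective (u v : V -> R) (t : R) (U := fun i => u i + t * v i) :
  is_derive t 1 (fun s : R => objective (fun i => u i + s * v i))
    (expR (- penalty U) * \sum_i mu i * v i *
       (h i * expR (U i) -
        mass U / (c * vol) * (c - p_laplacian e mu omega p U i))).
Proof.
have p0 : 0 < p by rewrite (lt_trans _ hp).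
have dZ (a : R) (f : R -> R) df : is_derive t 1 f df ->
    is_derive t 1 (fun s => a * f s) (a * df).
  exact: is_deriveZ.
have dM : is_derive t 1 (fun s : R => mass (fun i => u i + s * v i))
    (\sum_i mu i * h i * (expR (U i) * v i)).
  apply: is_derive_bigsum => i _; apply: (dZ).
  exact: is_derive_line.
have dE : is_derive t 1 (fun s : R => energy (fun i => u i + s * v i))
    (\sum_i \sum_(j | e i j) omega i j *
       (p * (`|U j - U i| `^ (p - 2) * (U j - U i)) * (v j - v i))).
  apply: is_derive_bigsum => i _; apply: is_derive_bigsum => j _.
  apply: (dZ).
  have lineE (s : R) : u j + s * v j - (u i + s * v i) =
    (u j - u i) + s * (v j - v i) by ring.
  rewrite (_ : (fun s : R => _) =
    (fun s : R => `|(u j - u i) + s * (v j - v i)| `^ p)); last first.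
    by apply/funext => s; rewrite lineE.
  rewrite /U lineE; apply: (@is_derive_line R (fun x => `|x| `^ p)).
  exact: is_derive_norm_powR.
have dL : is_derive t 1 (fun s : R => \sum_i mu i * (u i + s * v i))
    (\sum_i mu i * v i).
  apply: is_derive_bigsum => i _; apply: (dZ).
  rewrite -[v i in X in is_derive _ _ _ X]mul1r.
  exact: (@is_derive_line R id).
have {dE} {}dE : is_derive t 1 (fun s : R => energy (fun i => u i + s * v i))
    (- (2 * p) * \sum_i mu i * p_laplacian e mu omega p U i * v i).
  apply: (is_derive_eq dE); transitivity (p * \sum_i \sum_(j | e i j)
      omega i j * (`|U j - U i| `^ (p - 2) * (U j - U i)) * (v j - v i)).
    rewrite mulr_sumr; apply: eq_bigr => i _; rewrite mulr_sumr.
    by apply: eq_bigr => j _; ring.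
  by rewrite (p_laplacian_by_parts he homega _ _ _ hmu); ring.
set X := \sum_i mu i * _ * v i in dE.
set Y := \sum_i mu i * v i in dL.
set Z := \sum_i _ in dM.
have dP : is_derive t 1 (fun s : R => - penalty (fun i => u i + s * v i))
    (- (c * vol)^-1 * ((2 * p)^-1 * (- (2 * p) * X) + c * Y)).
  rewrite (_ : (fun s => _) = fun s : R => - (c * vol)^-1 *
    ((2 * p)^-1 * energy (fun i => u i + s * v i) +
     c * \sum_i mu i * (u i + s * v i))); last first.
    by apply/funext => s; rewrite /penalty; ring.
  apply: (dZ); apply: is_deriveD; exact: (dZ).
have dX := @is_derive1_comp R expR _ t _ _ (is_derive_expR _) dP.
have dObj := is_deriveM dM dX.
apply: (is_derive_eq dObj) => /=.
rewrite -/U.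
rewrite (_ : \sum_i mu i * v i * _ = Z - mass U / (c * vol) * (c * Y - X)).
  rewrite /GRing.scale/=; field.
  by rewrite !gt_eqF// vol_gt0.
rewrite /X /Y /Z !mulr_sumr -sumrB mulr_sumr -sumrB; apply: eq_bigr => i _.
ring.
Qed.

End Functional.

(** * The equation Delta_p u = c - h e^u *)

Unset Implicit Arguments.

Theorem theorem2p4 (R : realType) (V : finType) (e : rel V)
    (he : simple_graph e) (hconn : connected_graph e)
    (mu : V -> R) (hmu : forall i : V, 0 < mu i)
    (omega : V -> V -> R) (homega : edge_measure e omega)
    (p : R) (hp : 1 < p) (c : R) (hc : 0 < c) (h : V -> R) :
  (exists u : V -> R,
     forall i : V, p_laplacian e mu omega p u i = c - h i * expR (u i)) <->
  (exists i : V, 0 < h i).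
Proof.
have vol0 := vol_gt0 hmu hconn.
split=> [[u uE]|[k hk]].
  apply/not_existsP => hN.
  (* Testing against the constant 1 annihilates the left-hand side. *)
  have := p_laplacian_by_parts he homega p u (fun=> 1) hmu.
  rewrite big1 => [/esym/eqP|i _]; last first.
    by rewrite big1// => j _; rewrite subrr mulr0.
  rewrite mulf_eq0 oppr_eq0 pnatr_eq0/= gt_eqF//.
  rewrite (lt_le_trans (mulr_gt0 hc vol0))//.
  rewrite /vol mulr_sumr ler_sum// => i _.
  rewrite mulr1 mulrC ler_wpM2l ?(ltW (hmu i))// uE lerDl oppr_ge0.
  rewrite mulr_le0_ge0 ?expR_ge0// leNgt; exact/negP/hN.
have [w w0] : exists w : V -> R, 0 < mass mu h w.
  (* A function of height [T] at [k] and 0 elsewhere: since [expR T > T], the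
     contribution of [k] exceeds the bound [B] on all the others. *)
  pose B := \sum_(i | i != k) mu i * `|h i|.
  have mh0 : 0 < mu k * h k by rewrite mulr_gt0.
  pose T := B / (mu k * h k).
  exists (fun i => if i == k then T else 0).
  rewrite /mass (bigD1 k)//= eqxx.
  have hB : - B <=
      \sum_(i | i != k) mu i * h i * expR (if i == k then T else 0).
    rewrite /B -sumrN; apply: ler_sum => i /negbTE ->.
    by rewrite expR0 mulr1 -mulrN ler_wpM2l ?(ltW (hmu i))// lerNl -normrN
      ler_norm.
  have hT : B < mu k * h k * expR T.
    by rewrite mulrC -ltr_pdivrMr// (lt_le_trans _ (expR_ge1Dx T))// ltrDr.
  by rewrite -ltrBlDr sub0r (le_lt_trans _ hT)// lerNl.
have [|u umax] :=
    objective_attains_max (h := h) homega hmu hp hc hconn (w := w).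
  by rewrite mulr_gt0 ?expR_gt0.
have I0 : 0 < mass mu h u.
  have : 0 < objective e mu omega p c h u.
    by apply: lt_le_trans (umax w); rewrite mulr_gt0 ?expR_gt0.
  by rewrite pmulr_lgt0 ?expR_gt0.
set I := mass mu h u in I0.
have cv0 : 0 < c * vol mu by rewrite mulr_gt0.
have crit i : p_laplacian e mu omega p u i =
    c - (c * vol mu) / I * (h i * expR (u i)).
  (* The derivative in the direction of the indicator function of [i]. *)
  pose v j : R := (j == i)%:R.
  pose f (s : R) := objective e mu omega p c h (fun j => u j + s * v j).
  have df t := is_derive_objective h he homega hmu hp hc hconn u v t.
  have u0 : (fun j => u j + 0 * v j) = u.
    by apply/funext => j; rewrite mul0r addr0.
  have : is_derive (0 : R) 1 f 0.
    apply: (@derive1_at_max _ f (-1) 1).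
    - by rewrite (le_trans (lerN10 _)).
    - by move=> t _; exact: ex_derive.
    - by rewrite in_itv/= ltrN10 ltr01.
    - by move=> t _; rewrite /f u0.
  move=> /@derive_val; rewrite (@derive_val _ _ _ _ _ _ _ (df 0)) u0.
  move/eqP; rewrite mulf_eq0 gt_eqF ?expR_gt0//= (bigD1 i)//= big1; last first.
    by move=> j /negbTE ji; rewrite /v ji mulr0 mul0r.
  rewrite /v eqxx !(mulr1, mul0r, addr0) mulf_eq0 gt_eqF//= subr_eq0 => /eqP ->.
  by rewrite -/I; field; rewrite !gt_eqF.
(* The shift multiplies [expR (u i)] by [c * vol mu / I]. *)
exists (fun i => u i + ln ((c * vol mu) / I)) => i.
rewrite p_laplacian_shift crit expRD lnK ?posrE ?divr_gt0//; ring.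
Qed.
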